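(* Let $W:\mathcal{X}\to\mathcal{S}(B)$ be a cq-channel all of whose outputs are pure states, i.e. $W_x=|\psi_x\rangle\langle\psi_x|$ for unit vectors $|\psi_x\rangle\in B$, and let $\widetilde{\mathcal{X}}=W(\mathcal{X})$. Then \[ \dot{C}_{\rm DI}(W)=\frac12\,\underline{d}_M\!\left(\sqrt{\widetilde{\mathcal{X}}}\right)=\frac12\,\underline{d}_M\!\left(\widetilde{\mathcal{X}}\right). \]
   Context: A cq-channel is a measurable map $W:\mathcal{X}\to\mathcal{S}(B)$ from a measure space $\mathcal{X}$ to density operators on a finite-dimensional Hilbert space $B$; $W_{x^n}=W_{x_1}\otimes\cdots\otimes W_{x_n}$. An $(n,N,\lambda_1,\lambda_2)$-DI code for $W$ is $\{(u_j,E_j):j\in[N]\}$, $u_j\in\mathcal{X}^n$, $0\le E_j\le\mathbb{1}$ on $B^{\otimes n}$, with $\operatorname{Tr}W_{u_j}E_j\ge1-\lambda_1$ and $\operatorname{Tr}W_{u_j}E_k\le\lambda_2$ for all $j\ne k$; $N_{\rm DI}(n,\lambda_1,\lambda_2)$ is the largest such $N$, and $\dot{C}_{\rm DI}(W)=\inf_{\lambda_1,\lambda_2>0}\liminf_{n\to\infty}\frac{1}{n\log n}\log N_{\rm DI}(n,\lambda_1,\lambda_2)$ (logs base 2). $\sqrt{\widetilde{\mathcal{X}}}=\{\sqrt{\sigma}:\sigma\in\widetilde{\mathcal{X}}\}$. For a set $F$ of operators metrized by the Hilbert–Schmidt norm $\|X\|_2=\sqrt{\operatorname{Tr}X^*X}$,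 $\Pi_\delta(F)$ is the maximal number of points of $F$ with pairwise distance at least $\delta$, and $\underline{d}_M(F)=\liminf_{\delta\to0}\frac{\log\Pi_\delta(F)}{-\log\delta}$ is the lower Minkowski dimension. *)

(* Defs.v *)
From HB Require Import structures.
From mathcomp Require Import all_boot all_order all_algebra.
From mathcomp Require Import all_classical all_reals all_analysis.
From mathcomp Require Import complex.

Set Implicit Arguments.
Unset Strict Implicit.
Unset Printing Implicit Defensive.

Import Order.TTheory GRing.Theory Num.Theory.
Import numFieldTopology.Exports.
Local Open Scope classical_set_scope.
Local Open Scope ring_scope.

Section QDefs.
Variable R : realType.
Local Notation C := R[i].

Definition log2 (x : R) : R := ln x / ln 2.

(** positive semidefinite operator on the Hilbert space C^T (T a finite index
    set = orthonormal basis): <v, M v> >= 0 for all v.  The order on C = R[i]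
    is the one of numClosedFieldType: 0 <= z iff z is a nonnegative real. *)
Definition psd (T : finType) (M : T -> T -> C) : Prop :=
  forall v : T -> C, 0 <= \sum_(a : T) \sum_(b : T) Num.conj (v a) * M a b * v b.

Definition idop (T : finType) : T -> T -> C := fun a b => (a == b)%:R.

Definition effect (T : finType) (E : T -> T -> C) : Prop :=
  psd E /\ psd (fun a b => idop a b - E a b).

Definition trace_prod (T : finType) (A B : T -> T -> C) : C :=
  \sum_(a : T) \sum_(b : T) A a b * B b a.

Definition density_op (d : nat) (A : 'M[C]_d) : Prop :=
  psd (fun i j => A i j) /\ \tr A = 1.

Definition pure_state (d : nat) (A : 'M[C]_d) : Prop :=
  exists psi : 'I_d -> C,
    \sum_(i < d) Num.conj (psi i) * psi i = 1 /\
    forall i j, A i j = psi i * Num.conj (psi j).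

Section Channel.
Variables (d : nat) (X : Type) (W : X -> 'M[C]_d).

(** the basis of B^{(x)n} is indexed by words {ffun 'I_n -> 'I_d} *)
Definition word (n : nat) := {ffun 'I_n -> 'I_d}.

Definition tensW (n : nat) (u : 'I_n -> X) : word n -> word n -> C :=
  fun a b => \prod_(k < n) W (u k) (a k) (b k).

Definition is_DI_code (n N : nat) (l1 l2 : R)
    (u : 'I_N -> 'I_n -> X) (E : 'I_N -> word n -> word n -> C) : Prop :=
  (forall j, effect (E j)) /\
  (forall j, ((1 - l1)%:C)%C <= trace_prod (tensW (u j)) (E j)) /\
  (forall j k, j != k -> trace_prod (tensW (u j)) (E k) <= (l2%:C)%C).

(** log N_DI(n,l1,l2) / (n log n), as an extended real: the supremum over all
    achievable code sizes N >= 1 (this is +oo if N_DI is infinite and -oo if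
    no code with N >= 1 exists, i.e. log 0 = -oo). *)
Definition DI_rate (n : nat) (l1 l2 : R) : \bar R :=
  ereal_sup [set ((log2 N%:R) / (n%:R * log2 n%:R))%:E | N in
     [set N : nat | (0 < N)%N /\ exists u E, @is_DI_code n N l1 l2 u E]].

Definition DI_cap_dot : \bar R :=
  ereal_inf [set c | exists l1 l2 : R, 0 < l1 /\ 0 < l2 /\
                     c = limn_einf (fun n => DI_rate n l1 l2)].
End Channel.

Section Minkowski.
Variable d : nat.

Definition hs_norm (A : 'M[C]_d) : R :=
  Num.sqrt (complex.Re (\tr (map_mx Num.conj A^T *m A))).

Definition packing_ratio (F : set 'M[C]_d) (delta : R) : \bar R :=
  ereal_sup [set ((log2 N%:R) / (- log2 delta))%:E | N in
     [set N : nat | (0 < N)%N /\ exists f : 'I_N -> 'M[C]_d,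
         (forall i, F (f i)) /\
         (forall i j, i != j -> delta <= hs_norm (f i - f j))]].

Definition lower_minkowski_dim (F : set 'M[C]_d) : \bar R :=
  limf_einf (packing_ratio F) (0%R^'+).

Definition msqrt (A : 'M[C]_d) : 'M[C]_d :=
  xget 0 [set S : 'M[C]_d | psd (fun i j => S i j) /\ S *m S = A].
End Minkowski.

End QDefs.

(* Main.v *)
Require Import Defs.
From HB Require Import structures.
From mathcomp Require Import all_boot all_order all_algebra.
From mathcomp Require Import all_classical all_reals all_analysis.
From mathcomp Require Import complex ring lra.

Import Order.TTheory GRing.Theory Num.Theory.
Import numFieldNormedType.Exports.
Local Open Scope classical_set_scope.
Local Open Scope ring_scope.

(** For pure states the Hilbert-Schmidt distance determines the overlap:
    [|<psi_x, psi_y>|^2 = 1 - ||W_x - W_y||_2^2 / 2], and overlaps multiply along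
    words.

    Lower bound: take a [delta]-packing of the outputs with [delta = sqrt (c / n)]
    as alphabet, and a Gilbert-Varshamov code over it in which two words differ in
    a fixed (small) fraction of the positions.  Measuring the projector on the
    codeword itself has no error of the first kind, and the error of the second
    kind is at most [(1 - delta^2 / 2)^(n / m)], a constant made small by [c].

    Upper bound: with both errors at most 1/4, the overlap of two codewords is
    bounded away from 1.  If [delta = 1 / (4 sqrt n)], two words whose letters lie
    pairwise within [delta] of the same points of a maximal [delta]-packing would
    have a larger overlap, so a code has at most (packing number)^n words.

    In both cases [- log delta] is [(log n) / 2] up to a constant, which gives the
    factor 1/2.  Finally a rank one projector is its own square root. *)

(** * Quadratic forms, effects and rank one operators *)

Definition qform {R : realType} {T : finType} (M : T -> T -> R[i]) (v : T -> R[i]) : R[i] :=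
  \sum_a \sum_b (v a)^* * M a b * v b.

Definition dotc {R : realType} {T : finType} (v w : T -> R[i]) : R[i] :=
  \sum_a (v a)^* * w a.

Lemma qform_idop {R : realType} {T : finType} (v : T -> R[i]) :
  qform (idop R (T := T)) v = dotc v v.
Proof.
apply: eq_bigr => a _; rewrite (bigD1 a)//= /idop eqxx mulr1 big1 ?addr0//.
by move=> b /negbTE ba; rewrite eq_sym ba mulr0 mul0r.
Qed.

Lemma dotc_conj {R : realType} {T : finType} (v w : T -> R[i]) :
  (dotc v w)^* = dotc w v.
Proof.
rewrite /dotc rmorph_sum; apply: eq_bigr => a _.
by rewrite rmorphM /= conjCK mulrC.
Qed.

Lemma qform_parallelogram {R : realType} {T : finType} (M : T -> T -> R[i])
    (v w : T -> R[i]) :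
  qform M (fun a => v a + w a) + qform M (fun a => v a - w a) =
  2 * qform M v + 2 * qform M w.
Proof.
rewrite /qform !mulr_sumr -!big_split/=; apply: eq_bigr => a _.
rewrite !mulr_sumr -!big_split/=; apply: eq_bigr => b _.
rewrite rmorphB rmorphD/=; ring.
Qed.

Lemma qformZ {R : realType} {T : finType} (M : T -> T -> R[i]) (c : R[i])
    (v : T -> R[i]) :
  qform M (fun a => c * v a) = `|c| ^+ 2 * qform M v.
Proof.
rewrite /qform mulr_sumr; apply: eq_bigr => a _.
rewrite mulr_sumr; apply: eq_bigr => b _.
by rewrite rmorphM normCK; ring.
Qed.

Lemma qform_le_dotc {R : realType} {T : finType} (E : T -> T -> R[i])
    (v : T -> R[i]) : effect E -> qform E v <= dotc v v.
Proof.
move=> [_ /(_ v) h]; rewrite -qform_idop -subr_ge0 /qform -sumrB.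
apply: (le_trans h); rewrite le_eqVlt; apply/orP; left; apply/eqP; apply: eq_bigr => a _; rewrite -sumrB.
by apply: eq_bigr => b _; ring.
Qed.

Lemma trace_prod_rank1 {R : realType} {T : finType} (v : T -> R[i])
    (E : T -> T -> R[i]) :
  trace_prod (fun a b => v a * (v b)^*) E = qform E v.
Proof.
rewrite /trace_prod exchange_big; apply: eq_bigr => a _.
by apply: eq_bigr => b _; ring.
Qed.

Lemma qform_rank1 {R : realType} {T : finType} (v w : T -> R[i]) :
  qform (fun a b => v a * (v b)^*) w = `|dotc v w| ^+ 2.
Proof.
rewrite normCK dotc_conj mulrC /dotc mulr_suml; apply: eq_bigr => a _.
by rewrite mulr_sumr; apply: eq_bigr => b _; ring.
Qed.

(** Pythagoras: [r] is the part of [v] orthogonal to [w]. *)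
Lemma dotc_residual {R : realType} {T : finType} (v w : T -> R[i]) :
  dotc w w = 1 ->
  let r a := v a - dotc w v * w a in dotc r r = dotc v v - `|dotc w v| ^+ 2.
Proof.
move=> w1 /=; set c := dotc w v.
have -> : dotc (fun a => v a - c * w a) (fun a => v a - c * w a) =
   dotc v v - c * dotc v w - c^* * dotc w v + `|c| ^+ 2 * dotc w w.
  rewrite normCK /dotc !mulr_sumr -!sumrB -!big_split/=; apply: eq_bigr => a _.
  by rewrite rmorphB rmorphM/=; ring.
rewrite w1 -(dotc_conj w v) -/c normCK; ring.
Qed.

Lemma dotc_ge0 {R : realType} {T : finType} (v : T -> R[i]) : 0 <= dotc v v.
Proof. by rewrite sumr_ge0// => a _; rewrite mulrC -normCK exprn_ge0. Qed.

(* Split [v] into its component along [w] and the residual, and use that the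
   quadratic form of [E] satisfies [q (a + b) <= 2 q a + 2 q b]. *)
Lemma effect_overlap {R : realType} {T : finType} (E : T -> T -> R[i])
    (v w : T -> R[i]) :
  effect E -> dotc v v = 1 -> dotc w w = 1 ->
  qform E v <= 2 * `|dotc w v| ^+ 2 * qform E w + 2 * (1 - `|dotc w v| ^+ 2).
Proof.
move=> Eeff v1 w1; have [Epsd _] := Eeff; set c := dotc w v.
have := qform_parallelogram E (fun a => c * w a) (fun a => v a - c * w a).
have -> : qform E (fun a => c * w a + (v a - c * w a)) = qform E v.
  by congr qform; apply/funext => a; ring.
rewrite qformZ mulrA => eq2.
have le1 := qform_le_dotc _ (fun a => v a - c * w a) Eeff.
rewrite dotc_residual// v1 -/c in le1.
apply: (@le_trans _ _ (2 * `|c| ^+ 2 * qform E w +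
  2 * qform E (fun a => v a - c * w a))).
  rewrite -eq2 lerDl; exact: Epsd.
by rewrite lerD2l ler_pM2l.
Qed.

(** The complement is positive by Cauchy-Schwarz, which here is nonnegativity of the squared norm of
    the residual. *)
Lemma rank1_effect {R : realType} {T : finType} (v : T -> R[i]) :
  dotc v v = 1 -> effect (fun a b => v a * (v b)^*).
Proof.
move=> v1; split=> [w|w].
  by have := qform_rank1 v w; rewrite /qform => ->; rewrite exprn_ge0.
have -> : \sum_a \sum_b (w a)^* * (idop R a b - v a * (v b)^*) * w b =
   dotc w w - `|dotc v w| ^+ 2.
  rewrite -qform_rank1 -qform_idop /qform -sumrB; apply: eq_bigr => a _.
  by rewrite -sumrB; apply: eq_bigr => b _; ring.
by rewrite -dotc_residual// dotc_ge0.
Qed.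

(** * A Gilbert-Varshamov bound *)

(** By maximality every word agrees with some codeword in at least [g] places; a weighted count of
    such words bounds the code size from below. *)
Lemma gilbert_varshamov (T : finType) (n g : nat) :
  (0 < #|T|)%N -> (g <= n)%N ->
  exists (N : nat) (u : 'I_N -> {ffun 'I_n -> T}),
    (forall j k, j != k -> (#|[pred i | u j i == u k i]| < g)%N) /\
    (#|T| ^ g <= N * 2 ^ n)%N.
Proof.
move=> T0 gn.
pose agr (u v : {ffun 'I_n -> T}) := #|[pred i | u i == v i]|.
pose code (A : {set {ffun 'I_n -> T}}) :=
  [forall u in A, forall v in A, (u != v) ==> (agr u v < g)%N].
have [|A /maxsetP [Acode Amax]] := @ex_maxset _ code.
  by exists finset.set0; apply/forall_inP => u; rewrite finset.in_set0.
exists #|A|, (fun j => enum_val j); split.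
  move=> j k jk; move/forall_inP: Acode => /(_ _ (enum_valP j)).
  move=> /forall_inP /(_ _ (enum_valP k)) /implyP; apply.
  by apply: contra jk => /eqP /enum_val_inj ->.
have cover v : exists2 u, u \in A & (g <= agr u v)%N.
  apply: contrapT => far.
  have farlt u : u \in A -> (agr u v < g)%N.
    by move=> uA; rewrite ltnNge; apply/negP => ?; apply: far; exists u.
  have agrC w z : agr w z = agr z w.
    by apply: eq_card => i; rewrite !inE eq_sym.
  (* [v] agrees with itself in all [n >= g] places, so [farlt] keeps it out of [A]. *)
  have vA : v \notin A.
    apply/negP => /farlt; rewrite ltnNge /agr (eq_card (B := 'I_n)).
      by rewrite card_ord gn.
    by move=> i; rewrite !inE eqxx.
  have : code (v |: A)%SET.
    apply/forall_inP => u /setU1P uP; apply/forall_inP => w /setU1P wP.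
    apply/implyP => uw; case: uP wP => [uv|uA] [wv|wA].
    - by rewrite uv wv eqxx in uw.
    - by rewrite uv agrC farlt.
    - by rewrite wv farlt.
    - by move/forall_inP: Acode => /(_ _ uA) /forall_inP /(_ _ wA) /implyP; apply.
  move=> /Amax /(_ (finset.subsetUr _ _)) /setP /(_ v).
  by rewrite !finset.inE eqxx (negbTE vA).
(* Counting words close to [u]: words agreeing with [u] in at least [g] places
   have weight [wt u v >= #|T| ^ g], and the total weight factorizes. *)
pose wt (u v : {ffun 'I_n -> T}) := (#|T| ^ agr u v)%N.
have wtE u v : wt u v = (\prod_i (if u i == v i then #|T| else 1))%N.
  by rewrite /wt /agr -big_mkcond/= -prod_nat_const.
have sumwt w : (\sum_v wt w v <= (2 * #|T|) ^ n)%N.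
  under eq_bigr do rewrite wtE.
  rewrite -(bigA_distr_bigA (fun i x => if w i == x then #|T| else 1%N)).
  rewrite -[n in (_ ^ n)%N]card_ord -prod_nat_const; apply: leq_prod => i _.
  (* A position contributes [#|T|] for the matching letter and 1 for each other one. *)
  rewrite (bigD1 (w i))//= eqxx mul2n -addnn leq_add2l.
  under eq_bigr => x xu do rewrite eq_sym (negbTE xu).
  by rewrite sum1_card; apply: max_card.
have : (#|T| ^ g * #|T| ^ n <= #|A| * (2 * #|T|) ^ n)%N.
  rewrite -sum_nat_const; apply: (@leq_trans (\sum_(u in A) \sum_v wt u v)).
    have <- : #|{ffun 'I_n -> T}| = (#|T| ^ n)%N by rewrite card_ffun card_ord.
    rewrite exchange_big/= mulnC -sum_nat_const; apply: leq_sum => v _.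
    have [u uA uv] := cover v.
    rewrite (bigD1 u)//= (leq_trans _ (leq_addr _ _))//.
    exact: leq_pexp2l.
  exact: leq_sum.
by rewrite expnMn mulnA leq_pmul2r// expn_gt0 T0.
Qed.

(** * Hilbert-Schmidt distance and overlaps of pure states *)

Lemma hs_norm_sqr {R : realType} (d : nat) (A : 'M[R[i]]_d) :
  ((hs_norm A ^+ 2)%:C)%C = \sum_i \sum_j `|A i j| ^+ 2.
Proof.
have trE : \tr (map_mx Num.conj A^T *m A) = \sum_i \sum_j `|A i j| ^+ 2.
  rewrite exchange_big; apply: eq_bigr => j _; rewrite mxE; apply: eq_bigr => i _.
  by rewrite !mxE normCK mulrC.
have tr0 : 0 <= \tr (map_mx Num.conj A^T *m A).
  by rewrite trE; do 2!apply: sumr_ge0 => ? _; rewrite exprn_ge0.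
rewrite -trE /hs_norm sqr_sqrtr; last by move: tr0; rewrite lecE => /andP[].
by rewrite RRe_real// ger0_real.
Qed.

Lemma hs_norm_ge0 {R : realType} (d : nat) (A : 'M[R[i]]_d) : 0 <= hs_norm A.
Proof. exact: sqrtr_ge0. Qed.

Lemma hs_norm_sub {R : realType} (d : nat) (A B : 'M[R[i]]_d) :
  hs_norm (A - B) = hs_norm (B - A).
Proof.
rewrite -opprB /hs_norm.
have -> (C : 'M[R[i]]_d) : map_mx Num.conj (- C)^T = - map_mx Num.conj C^T.
  by apply/matrixP => i j; rewrite !mxE rmorphN.
by rewrite mulNmx mulmxN opprK.
Qed.

(** Entrywise parallelogram law with the term [|a + b - 2 z|^2] dropped; it serves as a triangle
    inequality for squares. *)
Lemma hs_norm_sqr_through {R : realType} (d : nat) (A B Z : 'M[R[i]]_d) :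
  hs_norm (A - B) ^+ 2 <= 2 * hs_norm (A - Z) ^+ 2 + 2 * hs_norm (B - Z) ^+ 2.
Proof.
have real_le (a b c : R) (a' b' c' : R[i]) : (a%:C)%C = a' -> (b%:C)%C = b' ->
    (c%:C)%C = c' -> a' <= 2 * b' + 2 * c' -> a <= 2 * b + 2 * c.
  move=> <- <- <-; rewrite -(rmorph_nat (real_complex R) 2).
  by rewrite -!rmorphM -rmorphD lecR.
apply: (real_le _ _ _ _ _ _ (hs_norm_sqr _ _) (hs_norm_sqr _ _) (hs_norm_sqr _ _)).
rewrite !mulr_sumr -!big_split/=; apply: ler_sum => i _.
rewrite !mulr_sumr -!big_split/=; apply: ler_sum => j _.
rewrite !mxE -subr_ge0; set a := A i j; set b := B i j; set z := Z i j.
suff -> : 2 * `|a - z| ^+ 2 + 2 * `|b - z| ^+ 2 - `|a - b| ^+ 2 =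
   `|a + b - 2 * z| ^+ 2 by rewrite exprn_ge0.
by rewrite !normCK !(rmorphB, rmorphD, rmorphM, rmorph_nat)/=; ring.
Qed.

(** Expanding the square gives [||A - B||_2^2 = 2 - 2 |<v, w>|^2] for unit vectors. *)
Lemma rank1_overlap {R : realType} (d : nat) (A B : 'M[R[i]]_d) (v w : 'I_d -> R[i]) :
  (forall i j, A i j = v i * (v j)^*) -> (forall i j, B i j = w i * (w j)^*) ->
  dotc v v = 1 -> dotc w w = 1 ->
  `|dotc v w| ^+ 2 = ((1 - hs_norm (A - B) ^+ 2 / 2)%:C)%C.
Proof.
move=> Avv Bww v1 w1; rewrite rmorphB rmorphM/= fmorphV rmorph_nat rmorph1.
rewrite hs_norm_sqr.
have -> : \sum_i \sum_j `|(A - B) i j| ^+ 2 =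
    dotc v v * dotc v v - dotc v w * dotc w v - dotc w v * dotc v w +
    dotc w w * dotc w w.
  rewrite /dotc !big_distrlr/= -!sumrB -!big_split/=; apply: eq_bigr => i _.
  rewrite -!sumrB -!big_split/=; apply: eq_bigr => j _.
  rewrite !mxE Avv Bww normCK rmorphB !rmorphM/= !conjCK; ring.
by rewrite v1 w1 -(dotc_conj v w) normCK; field.
Qed.

(* For pure states this is [|<psi_x, psi_y>|^2]; see [rank1_overlap]. *)
Definition fidelity {R : realType} {d : nat} {X : Type} (W : X -> 'M[R[i]]_d)
    (x y : X) : R := 1 - hs_norm (W x - W y) ^+ 2 / 2.

Lemma fidelity_le1 {R : realType} {d : nat} {X : Type} (W : X -> 'M[R[i]]_d) x y :
  fidelity W x y <= 1.
Proof. by rewrite gerBl divr_ge0// exprn_ge0// hs_norm_ge0. Qed.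

Lemma fidelity_ge0 {R : realType} {d : nat} {X : Type} (W : X -> 'M[R[i]]_d) x y :
  (forall x, pure_state (W x)) -> 0 <= fidelity W x y.
Proof.
move=> pureW; have [v [v1 vE]] := pureW x; have [w [w1 wE]] := pureW y.
by rewrite -ler0c -(rank1_overlap _ _ _ _ _ vE wE v1 w1) exprn_ge0.
Qed.

(** * Product states and the errors of a code *)

(** [Phi u] is the product of the letter vectors; distributing the sum over words factorizes inner
    products. *)
Lemma tensW_rank1 {R : realType} {d : nat} {X : Type} (W : X -> 'M[R[i]]_d) (n : nat) :
  (forall x, pure_state (W x)) ->
  exists Phi : ('I_n -> X) -> word d n -> R[i],
    [/\ forall u, tensW W u = fun a b => Phi u a * (Phi u b)^*,
        forall u, dotc (Phi u) (Phi u) = 1 &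
        forall u v, `|dotc (Phi u) (Phi v)| ^+ 2 =
                    ((\prod_i fidelity W (u i) (v i))%:C)%C].
Proof.
move=> /choice[psi psiP].
have dotPhi (u v : 'I_n -> X) :
    dotc (fun a : word d n => \prod_k psi (u k) (a k))
         (fun a : word d n => \prod_k psi (v k) (a k)) =
    \prod_k dotc (psi (u k)) (psi (v k)).
  rewrite /dotc bigA_distr_bigA; apply: eq_bigr => a _.
  by rewrite rmorph_prod -big_split.
exists (fun u a => \prod_k psi (u k) (a k)); split.
- move=> u; apply/funext => a; apply/funext => b.
  rewrite rmorph_prod -big_split; apply: eq_bigr => k _.
  by have [_ ->] := psiP (u k).
- by move=> u; rewrite dotPhi big1// => k _; have [] := psiP (u k).
- move=> u v; rewrite dotPhi normr_prod -prodrXl rmorph_prod.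
  apply: eq_bigr => k _; have [v1 vE] := psiP (u k); have [w1 wE] := psiP (v k).
  exact: rank1_overlap.
Qed.

Lemma projective_DI_code {R : realType} {d : nat} {X : Type} (W : X -> 'M[R[i]]_d)
    (n N : nat) (l1 l2 : R) (u : 'I_N -> 'I_n -> X) :
  (forall x, pure_state (W x)) -> 0 <= l1 ->
  (forall j k, j != k -> \prod_i fidelity W (u j i) (u k i) <= l2) ->
  is_DI_code W l1 l2 u (fun j => tensW W (u j)).
Proof.
move=> pureW l10 ul2; have [Phi [PhiE Phi1 Phi2]] := tensW_rank1 W n pureW.
split; [|split] => [j|j|j k jk]; rewrite !PhiE ?trace_prod_rank1 ?qform_rank1.
- exact: rank1_effect.
- by rewrite Phi1 normr1 expr1n -(rmorph1 (real_complex R)) lecR gerBl.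
- by rewrite Phi2 lecR ul2// eq_sym.
Qed.

(** The overlap bound reads [1 - l1 <= 2 f l2 + 2 (1 - f)]; with both errors 1/4 it forces
    [f <= 5/6]. *)
Lemma effect_overlap_error {R : realType} {T : finType} (E : T -> T -> R[i])
    (v w : T -> R[i]) (f l1 l2 : R) :
  effect E -> dotc v v = 1 -> dotc w w = 1 -> `|dotc w v| ^+ 2 = (f%:C)%C ->
  ((1 - l1)%:C)%C <= qform E v -> qform E w <= (l2%:C)%C ->
  2 * (1 - l2) * f <= 1 + l1.
Proof.
move=> Eeff v1 w1 fE h1 h2; have := effect_overlap E v w Eeff v1 w1.
have f0 : 0 <= (f%:C)%C by rewrite -fE exprn_ge0.
rewrite fE; move=> /(le_trans h1).
have : 2 * (f%:C)%C * qform E w <= 2 * (f%:C)%C * (l2%:C)%C.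
  by rewrite ler_wpM2l// mulr_ge0.
rewrite -(lerD2r (2 * (1 - (f%:C)%C))) => le2 /le_trans/(_ le2).
rewrite -(rmorph_nat (real_complex R) 2) -(rmorph1 (real_complex R)).
rewrite -!(rmorphB, rmorphM, rmorphD)/= lecR; lra.
Qed.

Lemma DI_code_fidelity {R : realType} {d : nat} {X : Type} (W : X -> 'M[R[i]]_d)
    (n N : nat) (l1 l2 : R) (u : 'I_N -> 'I_n -> X)
    (E : 'I_N -> word d n -> word d n -> R[i]) :
  (forall x, pure_state (W x)) -> is_DI_code W l1 l2 u E ->
  forall j k, j != k ->
  2 * (1 - l2) * \prod_i fidelity W (u j i) (u k i) <= 1 + l1.
Proof.
move=> pureW [Eeff [El1 El2]] j k jk.
have [Phi [PhiE Phi1 Phi2]] := tensW_rank1 W n pureW.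
have kj : k != j by rewrite eq_sym.
have -> : \prod_i fidelity W (u j i) (u k i) = \prod_i fidelity W (u k i) (u j i).
  by apply: eq_bigr => i _; rewrite /fidelity hs_norm_sub.
apply: (effect_overlap_error _ _ _ _ _ _ (Eeff j) (Phi1 (u j)) (Phi1 (u k))
  (Phi2 _ _)).
- by have := El1 j; rewrite PhiE trace_prod_rank1.
- by have := El2 k j kj; rewrite PhiE trace_prod_rank1.
Qed.

(** * The square root of a pure state *)

Lemma psd_hermitian {R : realType} {T : finType} (M : T -> T -> R[i]) (a b : T) :
  psd M -> (M a b)^* = M b a.
Proof.
(* Polarization: the diagonal values of the form at [e_a + e_b] and
   [e_a + 'i e_b] are real. *)
move=> Mpsd; pose e (a c : T) : R[i] := (c == a)%:R.
pose h (v w : T -> R[i]) := \sum_i \sum_j (v i)^* * M i j * w j.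
have he x y : h (e x) (e y) = M x y.
  rewrite /h (bigD1 x)//= [X in _ + X]big1 ?addr0 => [|i /negbTE ix]; last first.
    by rewrite big1// => j _; rewrite /e ix conjC0 !mul0r.
  rewrite (bigD1 y)//= big1 ?addr0 => [|j /negbTE jy]; last by rewrite /e jy mulr0.
  by rewrite /e !eqxx conjC1 mul1r mulr1.
have hD v w z : h (fun c => v c + z * w c) (fun c => v c + z * w c) =
    h v v + z * h v w + z^* * h w v + `|z| ^+ 2 * h w w.
  rewrite normCK /h !mulr_sumr -!big_split/=; apply: eq_bigr => i _.
  rewrite !mulr_sumr -!big_split/=; apply: eq_bigr => j _.
  by rewrite rmorphD rmorphM/=; ring.
have hreal v : (h v v)^* = h v v by apply: geC0_conj; exact: Mpsd.
have := hreal (fun c => e a c + 1 * e b c); rewrite hD.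
have := hreal (fun c => e a c + 'i * e b c); rewrite hD.
rewrite normCi conjC1 normr1 !expr1n !mul1r !rmorphD/= !rmorphM/= conjCK conjCi.
rewrite !hreal !he.
set x := M a b; set y := M b a; set p := M a a; set q := M b b => Ei E1.
have Es : x^* + y^* = x + y.
  by apply: (addIr q); apply: (addrI p); move: E1; rewrite !addrA.
have Ed : x^* - y^* = y - x.
  apply: (mulfI (neq0Ci R[i])); apply: oppr_inj.
  apply: (addIr q); apply: (addrI p); apply: etrans (etrans Ei _); ring.
apply: (mulfI (_ : 2 != 0 :> R[i])); first by rewrite pnatr_eq0.
transitivity ((x^* + y^*) + (x^* - y^*)); first by ring.
by rewrite Es Ed; ring.
Qed.

Lemma gram_eq0 {R : realType} (d : nat) (A : 'M[R[i]]_d) :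
  map_mx Num.conj A^T *m A = 0 -> A = 0.
Proof.
move=> A0; have := hs_norm_sqr _ A; rewrite /hs_norm A0 mxtrace0 /= sqrtr0 expr0n/=.
move/esym/eqP; rewrite psumr_eq0 => [/allP rows|i _]; last first.
  by apply: sumr_ge0 => j _; rewrite exprn_ge0.
apply/matrixP => i j; rewrite mxE; have := rows i (mem_index_enum _).
rewrite psumr_eq0 => [/allP/(_ j (mem_index_enum _))|k _]; last by rewrite exprn_ge0.
by rewrite /= sqrf_eq0 normr_eq0 => /eqP.
Qed.

Lemma msqrt_pure {R : realType} (d : nat) (P : 'M[R[i]]_d) :
  pure_state P -> msqrt P = P.
Proof.
move=> [psi [psi1 PE]]; apply: xget_unique.
  split=> [v|]; last first.
    apply/matrixP => i j; rewrite mxE PE -[RHS]mulr1 -psi1 mulr_sumr.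
    by apply: eq_bigr => k _; rewrite !PE; ring.
  have -> : \sum_i \sum_j (v i)^* * P i j * v j = `|dotc psi v| ^+ 2.
    rewrite -qform_rank1; apply: eq_bigr => i _; apply: eq_bigr => j _.
    by rewrite PE.
  by rewrite exprn_ge0.
have PP : P *m P = P.
  apply/matrixP => i j; rewrite mxE PE -[RHS]mulr1 -psi1 mulr_sumr.
  by apply: eq_bigr => k _; rewrite !PE; ring.
(* A square root [S] commutes with [P = S ^ 2], so [S P] is a nonnegative multiple
   of [P], hence [P]; and [S (1 - P)] has Gram matrix [(1 - P) P (1 - P) = 0]. *)
move=> S [Spsd SS]; pose c := qform (fun i j => S i j) psi.
have c0 : 0 <= c := Spsd psi.
have PSP : P *m S *m P = c *: P.
  apply/matrixP => i j; rewrite !mxE /c /qform mulr_suml.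
  under eq_bigr do rewrite mxE mulr_suml.
  rewrite exchange_big/=; apply: eq_bigr => k _; rewrite mulr_suml.
  by apply: eq_bigr => l _; rewrite !PE; ring.
have PS : P *m S = S *m P by rewrite -SS mulmxA.
have SP : S *m P = c *: P by rewrite -PSP PS -mulmxA PP.
(* The trace gives [c ^ 2 = 1], and [c >= 0] rules out -1. *)
have c1 : c = 1.
  have : P = (c * c) *: P by rewrite -{1}PP -{1}SS -mulmxA SP -scalemxAr SP scalerA.
  move/(congr1 mxtrace); rewrite mxtraceZ.
  have -> : \tr P = 1.
    by rewrite -psi1; apply: eq_bigr => k _; rewrite PE mulrC.
  rewrite mulr1 -expr2 => /esym/eqP; rewrite sqrf_eq1 => /orP[/eqP//|/eqP c_N1].
  by move: c0; rewrite c_N1 lerNr oppr0 ler10.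
have SQ0 : S *m (1%:M - P) = 0.
  apply: gram_eq0.
  have -> : map_mx Num.conj (S *m (1%:M - P))^T = (1%:M - P) *m S.
    have SH : map_mx Num.conj S^T = S.
      apply/matrixP => i j; rewrite !mxE.
      exact: (psd_hermitian (fun i j => S i j)).
    have PH : map_mx Num.conj P^T = P.
      by apply/matrixP => i j; rewrite !mxE !PE rmorphM/= conjCK mulrC.
    rewrite trmx_mul map_mxM SH; congr (_ *m _).
    by rewrite linearB/= trmx1 map_mxB map_mx1 PH.
  rewrite mulmxA -(mulmxA _ S S) SS mulmxBl mul1mx PP subrr.
  by rewrite mul0mx.
by move: SQ0; rewrite mulmxBr mulmx1 SP c1 scale1r => /eqP; rewrite subr_eq0 => /eqP.
Qed.

(** * Limits inferior, logarithms and elementary estimates *)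

Lemma lt_limf_einf_near {R : realType} {T : choiceType} {X : filteredType T}
    (F : set_system X) (FF : Filter F) (f : X -> \bar R) (a : \bar R) :
  (a < limf_einf f F)%E -> \forall x \near F, (a < f x)%E.
Proof.
rewrite limf_einfE => /ereal_sup_gt[_ [V FV <-] aV].
apply: filterS FV => x Vx; apply: (lt_le_trans aV).
by apply: ereal_inf_lbound; exists x.
Qed.

Lemma limf_einf_ge_near {R : realType} {T : choiceType} {X : filteredType T}
    (F : set_system X) (f : X -> \bar R) (a : \bar R) :
  (\forall x \near F, (a <= f x)%E) -> (a <= limf_einf f F)%E.
Proof.
move=> Fa; rewrite limf_einfE; apply: le_trans (ereal_sup_ubound _); last first.
  by exists [set x | (a <= f x)%E].
by apply: le_ereal_inf_tmp => _ [x ax <-].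
Qed.

Lemma log2M {R : realType} (x y : R) : 0 < x -> 0 < y ->
  log2 (x * y) = log2 x + log2 y.
Proof. by move=> x0 y0; rewrite /log2 lnM ?posrE// mulrDl. Qed.

Lemma log2V {R : realType} (x : R) : 0 < x -> log2 x^-1 = - log2 x.
Proof. by move=> x0; rewrite /log2 lnV ?posrE// mulNr. Qed.

Lemma log2X {R : realType} (x : R) n : 0 < x -> log2 (x ^+ n) = n%:R * log2 x.
Proof. by move=> x0; rewrite /log2 lnXn// -(mulr_natl (ln x)) mulrA. Qed.

Lemma log2_2 {R : realType} : log2 (2 : R) = 1.
Proof. by rewrite /log2 divff// gt_eqF// ln_gt0// ltr1n. Qed.

Lemma ler_log2 {R : realType} (x y : R) : 0 < x -> x <= y -> log2 x <= log2 y.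
Proof.
move=> x0 xy; rewrite /log2 ler_wpM2r//; first by rewrite invr_ge0 ln_ge0// ler1n.
by rewrite ler_ln ?posrE// (lt_le_trans x0 xy).
Qed.

Lemma log2_ge0 {R : realType} (x : R) : 1 <= x -> 0 <= log2 x.
Proof. by move=> x1; rewrite /log2 divr_ge0 ?ln_ge0// ler1n. Qed.

Lemma log2_gt0 {R : realType} (x : R) : 1 < x -> 0 < log2 x.
Proof. by move=> x1; rewrite /log2 divr_gt0 ?ln_gt0// ltr1n. Qed.

Lemma cvg_log2_natr {R : realType} : (log2 n%:R : R) @[n --> \oo] --> +oo.
Proof.
apply/cvgryPge => A; near=> n.
have : expR (A * ln 2) <= n%:R by near: n; exact: nbhs_infty_ger.
move=> /(ler_log2 _ _ (expR_gt0 _)); apply: le_trans.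
by rewrite /log2 expRK mulfK// gt_eqF// ln_gt0// ltr1n.
Unshelve. all: by end_near. Qed.

Lemma log2_sqrt {R : realType} (x : R) : 0 < x -> log2 (Num.sqrt x) = log2 x / 2.
Proof.
move=> x0; have s0 : 0 < Num.sqrt x by rewrite sqrtr_gt0.
by rewrite -[in RHS](sqr_sqrtr (ltW x0)) log2X//; field.
Qed.

(** Comparing through real lower bounds lets the limit arguments work with a finite [b]. *)
Lemma lee_EFin_approx {R : realType} (x y : \bar R) :
  (forall b : R, (b%:E < x)%E -> (b%:E <= y)%E) -> (x <= y)%E.
Proof.
move: x y => [x| |] [y| |] H; rewrite ?leey ?leNye//.
- rewrite leNgt; apply/negP; rewrite lte_fin => yx.
  have := H ((x + y) / 2); rewrite lte_fin lee_fin; lra.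
- by have := H (x - 1); rewrite lte_fin; move=> /(_ ltac:(lra)); rewrite leeNy_eq.
- by have := H (y + 1); rewrite ltry lee_fin gerDl ler10 => /(_ isT).
- by have := H 0 (ltry _); rewrite leeNy_eq.
Qed.

Lemma bernoulli_le {R : realFieldType} (t : R) n :
  0 <= t <= 1 -> 1 - n%:R * t <= (1 - t) ^+ n.
Proof.
move=> /andP[t0 t1]; elim: n => [|n IH]; first by rewrite mul0r subr0 expr0.
rewrite exprS -natr1; apply: le_trans (_ : (1 - t) * (1 - n%:R * t) <= _).
  have : 0 <= n%:R * (t * t) by rewrite !mulr_ge0.
  lra.
by rewrite ler_wpM2l// subr_ge0.
Qed.

(** * Packings and the code sizes they allow *)

Definition packing {R : realType} {d : nat} (F : set 'M[R[i]]_d) (delta : R)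
    (M : nat) :=
  exists f : 'I_M -> 'M[R[i]]_d, (forall i, F (f i)) /\
    (forall i j, i != j -> delta <= hs_norm (f i - f j)).

Lemma packing_ratio_ge {R : realType} {d : nat} (F : set 'M[R[i]]_d) (delta : R) M :
  (0 < M)%N -> packing F delta M ->
  ((log2 M%:R / - log2 delta)%:E <= packing_ratio F delta)%E.
Proof. by move=> M0 pM; apply: ereal_sup_ubound; exists M. Qed.

Lemma lt_packing_ratio {R : realType} {d : nat} (F : set 'M[R[i]]_d) (delta a : R) :
  (a%:E < packing_ratio F delta)%E ->
  exists M, [/\ (0 < M)%N, packing F delta M & a < log2 M%:R / - log2 delta].
Proof. by move=> /ereal_sup_gt[_ [M [M0 pM] <-]]; rewrite lte_fin; exists M. Qed.

(* [packing_ratio F delta] may be [-oo] (when [F] is empty); then [M = 0]. *)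
Lemma maximal_packing {R : realType} {d : nat} (F : set 'M[R[i]]_d) (delta : R) :
  0 < delta < 1 -> (packing_ratio F delta < +oo)%E ->
  exists M, packing F delta M /\ ~ packing F delta M.+1.
Proof.
move=> /andP[d0 d1] ratio_fin; apply: contrapT => nmax.
(* Without a maximal size there are packings of every size, and the ratio is infinite. *)
have pM M : packing F delta M.
  elim: M => [|M IH].
    have f0 : 'I_0 -> 'M[R[i]]_d by case.
    by exists f0; split; case.
  by apply: contrapT => npM; apply: nmax; exists M.
have ld : 0 < - log2 delta by rewrite -log2V// log2_gt0// invf_gt1.
move: ratio_fin; rewrite ltNge => /negP; apply.
apply: lee_EFin_approx => b _.
have /cvgryPge /(_ (b * - log2 delta)) := @cvg_log2_natr R.
move=> [M _ MP]; have := MP M.+1 (leqnSn _) => /= bM.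
apply: le_trans (packing_ratio_ge _ _ M.+1 isT (pM _)).
by rewrite lee_fin ler_pdivlMr.
Qed.

Lemma DI_code_of_packing {R : realType} {d : nat} {X : Type} (W : X -> 'M[R[i]]_d)
    (delta l1 l2 : R) (M n g : nat) :
  (forall x, pure_state (W x)) -> 0 <= l1 -> 0 <= delta ->
  expR (- (delta ^+ 2 / 2 * (n - g)%:R)) <= l2 ->
  packing (range W) delta M -> (0 < M)%N -> (g <= n)%N ->
  exists N, [/\ (0 < N)%N, exists u E, @is_DI_code _ _ _ W n N l1 l2 u E &
                (M ^ g <= N * 2 ^ n)%N].
Proof.
move=> pureW l10 d0 el2 [f [fW fd]] M0 gn.
have /choice[xs xsE] i : exists x, W x = f i by have [x _ <-] := fW i; exists x.
have [|N [u [uagr uN]]] := @gilbert_varshamov 'I_M n g _ gn; first by rewrite card_ord.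
rewrite card_ord in uN; exists N; split => //.
  by case: N uN {u uagr} => //; rewrite mul0n leqn0 expn_eq0 (gtn_eqF M0).
exists (fun j i => xs (u j i)); eexists; apply: projective_DI_code => // j k jk.
(* [e] bounds the fidelity at a position with different letters, by [1 - t <= exp (- t)]. *)
apply: le_trans el2; set e := expR (- (delta ^+ 2 / 2)).
have e1 : e <= 1 by rewrite -expR0 ler_expR lerNl oppr0 divr_ge0// exprn_ge0.
apply: (@le_trans _ _ (\prod_i (if u j i != u k i then e else 1))).
  apply: ler_prod => i _; rewrite fidelity_ge0//=.
  case: eqVneq => [_|uu]; first exact: fidelity_le1.
  apply: le_trans (expR_ge1Dx _); rewrite lerD2l lerN2 !xsE.
  by rewrite ler_pM2r ?invr_gt0// lerXn2r ?nnegrE ?hs_norm_ge0// fd.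
rewrite -big_mkcond/= prodr_const -mulNr mulrC expRM_natl.
rewrite -/e ler_wiXn2l// ?expR_ge0//.
(* Fewer than [g] agreements leave at least [n - g] differing positions. *)
have := uagr _ _ jk; rewrite -(leq_add2l #|[pred i | u j i != u k i]|).
have := cardC [pred i | u j i != u k i]; rewrite card_ord.
rewrite (@eq_card _ [predC _] [pred i | u j i == u k i]); last first.
  by move=> i; rewrite !inE negbK.
by move=> cardE; rewrite addnS cardE => /ltnW; rewrite leq_subLR addnC.
Qed.

(** Rounding letters to nearby packing points is injective on codewords: in a collision each letter
    fidelity is at least [1 - 2 delta^2], so the product is at least [1 - 2 n delta^2 >= 7/8], above
    the 5/6 that the errors allow. *)
Lemma DI_code_size_le {R : realType} {d : nat} {X : Type} (W : X -> 'M[R[i]]_d)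
    (delta : R) (M n N : nat) (u : 'I_N -> 'I_n -> X) E :
  (forall x, pure_state (W x)) -> 0 <= delta -> 16 * n%:R * delta ^+ 2 <= 1 ->
  packing (range W) delta M -> ~ packing (range W) delta M.+1 ->
  is_DI_code W 4^-1 4^-1 u E -> (N <= M ^ n)%N.
Proof.
move=> pureW d0 nd [f [fW fd]] nM code.
have cover x : exists i, hs_norm (W x - f i) < delta.
  apply: contrapT => far; apply: nM.
  have far' i : delta <= hs_norm (W x - f i).
    by rewrite leNgt; apply/negP => ?; apply: far; exists i.
  (* [W x] is added at index [ord0], which would give a packing of [M.+1] points. *)
  exists (fun j => if unlift ord0 j is Some i then f i else W x); split => [j|j k].
    by case: unliftP => [i _|_]; [exact: fW|exists x].
  case: unliftP => [i ->|->]; case: unliftP => [i' ->|->] //= jk.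
  - by apply: fd; apply: contra jk => /eqP ->.
  - by rewrite hs_norm_sub far'.
have [c cP] := choice cover.
pose h j : {ffun 'I_n -> 'I_M} := [ffun k => c (u j k)].
suff /leq_card : injective h by rewrite card_ffun !card_ord.
move=> j k hjk; apply/eqP; apply: contraT => jk.
have := DI_code_fidelity _ _ _ _ _ _ _ pureW code _ _ jk.
have fid i : 1 - 2 * delta ^+ 2 <= fidelity W (u j i) (u k i).
  have := hs_norm_sqr_through _ (W (u j i)) (W (u k i)) (f (c (u j i))).
  have cc : c (u k i) = c (u j i) by move/ffunP: hjk => /(_ i); rewrite !ffunE.
  have sq y : hs_norm (W y - f (c y)) ^+ 2 <= delta ^+ 2.
    by rewrite lerXn2r ?nnegrE ?hs_norm_ge0// ltW.
  have := sq (u j i); have := sq (u k i); rewrite cc /fidelity; lra.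
(* At length 0 [nd] does not bound [delta], but the empty product is already 1 > 5/6. *)
case: n u E nd code h hjk fid => [|n] u E nd code h hjk fid.
  by rewrite big_ord0; lra.
have d2 : 16 * delta ^+ 2 <= 1.
  apply: le_trans nd; rewrite -mulrA ler_pM2l// ler_peMl ?exprn_ge0//.
  by rewrite ler1n.
have := bernoulli_le (2 * delta ^+ 2) n.+1.
have dd : 0 <= delta ^+ 2 by rewrite exprn_ge0.
have -> : 0 <= 2 * delta ^+ 2 <= 1 by apply/andP; split; lra.
have : (1 - 2 * delta ^+ 2) ^+ n.+1 <= \prod_i fidelity W (u j i) (u k i).
  rewrite -[in X in X <= _](card_ord n.+1) -prodr_const; apply: ler_prod => i _.
  by rewrite fid andbT; lra.
move=> le1 /(_ isT) le2; have := le_trans le2 le1; lra.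
Qed.

(** * Asymptotic rates and the capacity *)

Lemma DI_rate_ge {R : realType} {d : nat} {X : Type} (W : X -> 'M[R[i]]_d)
    (n N : nat) (l1 l2 : R) :
  (0 < N)%N -> (exists u E, @is_DI_code _ _ _ W n N l1 l2 u E) ->
  ((log2 N%:R / (n%:R * log2 n%:R))%:E <= DI_rate W n l1 l2)%E.
Proof. by move=> N0 NE; apply: ereal_sup_ubound; exists N. Qed.

Lemma lt_DI_rate {R : realType} {d : nat} {X : Type} (W : X -> 'M[R[i]]_d)
    (n : nat) (l1 l2 a : R) :
  (a%:E < DI_rate W n l1 l2)%E ->
  exists N, [/\ (0 < N)%N, exists u E, @is_DI_code _ _ _ W n N l1 l2 u E &
                a < log2 N%:R / (n%:R * log2 n%:R)].
Proof. by move=> /ereal_sup_gt[_ [N [N0 NE] <-]]; rewrite lte_fin; exists N. Qed.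

Lemma EFin_lt_dense {R : realFieldType} (b : R) (y : \bar R) :
  (b%:E < y)%E -> exists2 a, b < a & (a%:E < y)%E.
Proof.
case: y => [r| |]; rewrite ?lte_fin => br.
- by exists ((b + r) / 2); rewrite ?lte_fin; lra.
- by exists (b + 1); rewrite ?ltry ?ltrDl.
- by [].
Qed.

(* [k] accounts for the constant in [delta = sqrt (c / n)], i.e.
   [- log2 delta = log2 n / 2 - k], and [m] for the agreement fraction
   [1 - 1 / m] of the Gilbert-Varshamov code. *)
Lemma near_rate_bound {R : realType} (m : nat) (a k b : R) :
  b < (1 - m%:R^-1) * (a / 2) ->
  \forall n \near \oo,
    b < (1 - m%:R^-1 - n%:R^-1) * (a * (2^-1 - k * (log2 n%:R)^-1)) - (log2 n%:R)^-1.
Proof.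
move=> bm.
have invn : ((n%:R : R)^-1) @[n --> \oo] --> (0 : R).
  apply/gtr0_cvgV0; last exact: cvgr_idn.
  by near=> n; rewrite ltr0n; near: n; exact: nbhs_infty_gt.
have invl : ((log2 n%:R : R)^-1) @[n --> \oo] --> (0 : R).
  apply/gtr0_cvgV0; last exact: cvg_log2_natr.
  by near=> n; rewrite log2_gt0// ltr1n; near: n; exact: nbhs_infty_gt.
suff : (1 - m%:R^-1 - n%:R^-1) * (a * (2^-1 - k * (log2 n%:R)^-1)) - (log2 n%:R)^-1
    @[n --> \oo] --> (1 - m%:R^-1 - 0) * (a * (2^-1 - k * 0)) - 0.
  by rewrite !subr0 mulr0 subr0 => /cvgr_gt; apply.
apply: cvgB => //; apply: cvgM; first by apply: cvgB => //; exact: cvg_cst.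
apply: cvgM; first exact: cvg_cst.
apply: cvgB; first exact: cvg_cst.
by apply: cvgM => //; exact: cvg_cst.
Unshelve. all: by end_near. Qed.

Lemma liminf_DI_rate_ge {R : realType} {d : nat} {X : Type} (W : X -> 'M[R[i]]_d)
    (l1 l2 : R) :
  (forall x, pure_state (W x)) -> 0 < l1 -> 0 < l2 ->
  ((2%R^-1)%:E * lower_minkowski_dim (range W) <=
   limn_einf (fun n => DI_rate W n l1 l2))%E.
Proof.
move=> pureW l10 l20; apply: lee_EFin_approx => b.
rewrite lte_pdivlMl// -EFinM => /EFin_lt_dense[a ba aD].
have := lt_limf_einf_near _ _ _ _ aD; rewrite /= => near_a.
(* Raising [a] to 0 is harmless because [log2 M >= 0], and makes multiplication by it monotone. *)
pose a' := Num.max a 0; have a'0 : 0 <= a' by rewrite le_max lexx orbT.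
have ba' : 2 * b < a' by rewrite lt_max ba.
have [m m2 bm] : exists2 m, (1 < m)%N & b < (1 - m%:R^-1) * (a' / 2).
  (* Chosen so that [t * a' < a' - 2 * b]; the extra summand keeps the denominator positive when
     [a'] is 0. *)
  pose t := (a' - 2 * b) / (2 * (a' - 2 * b) + a').
  have t0 : 0 < t by rewrite divr_gt0//; lra.
  have [j] := ltr_add_invr t0; rewrite add0r => jt.
  have mt : j.+2%:R^-1 < t by apply: le_lt_trans jt; rewrite lef_pV2 ?posrE// ler_nat.
  exists j.+2 => //; move: mt; set x := j.+2%:R^-1 => mt.
  have : x * a' <= t * a' by rewrite ler_wpM2r// ltW.
  have : t * a' < a' - 2 * b.
    by rewrite /t mulrAC ltr_pdivrMr ?ltr_pM2l; lra.
  lra.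
have m0 : 0 < m%:R :> R by rewrite ltr0n (ltn_trans _ m2).
(* Makes [delta^2 / 2 * (n / m)] equal to [|ln l2| + 1], hence at least [- ln l2]. *)
pose c := 2 * m%:R * (`|ln l2| + 1).
have c0 : 0 < c by rewrite mulr_gt0 ?mulr_gt0// ltr_wpDl.
pose k := log2 c / 2.
have [e /= e0 eP] := near_a.
apply: limf_einf_ge_near; near=> n.
have n1 : (1 < n)%N by near: n; exact: nbhs_infty_gt.
have n0 : 0 < n%:R :> R by rewrite ltr0n ltnW.
pose delta := Num.sqrt (c / n%:R).
have cn0 : 0 < c / n%:R by rewrite divr_gt0.
have delta0 : 0 < delta by rewrite sqrtr_gt0.
have delta_e : delta < e.
  rewrite -[e]gtr0_norm// -sqrtr_sqr ltr_sqrt ?exprn_gt0//.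
  rewrite ltr_pdivrMr// mulrC -ltr_pdivrMr ?exprn_gt0//.
  by near: n; exact: nbhs_infty_gtr.
have delta1 : delta < 1.
  rewrite -[X in _ < X]sqrtr1 ltr_sqrt// ltr_pdivrMr// mul1r.
  by near: n; exact: nbhs_infty_gtr.
have ldelta : - log2 delta = log2 n%:R / 2 - k.
  by rewrite log2_sqrt// log2M ?invr_gt0// log2V// /k; lra.
have ldelta0 : 0 < - log2 delta by rewrite -log2V// log2_gt0// invf_gt1.
have /lt_packing_ratio[M [M0 pM aM]] : (a%:E < packing_ratio (range W) delta)%E.
  by apply: eP => //=; rewrite sub0r normrN gtr0_norm.
have a'M : a' * - log2 delta <= log2 M%:R.
  rewrite /a'; case: (leP a 0) => _; first by rewrite mul0r log2_ge0// ler1n.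
  by rewrite -ler_pdivlMr// ltW.
(* The successor rounds up, so [n - g >= n / m]; if the subtraction truncates, [g = 0] and this
   still holds. *)
pose g := (n - (n %/ m).+1)%N.
have gn : (g <= n)%N by exact: leq_subr.
have el2 : expR (- (delta ^+ 2 / 2 * (n - g)%:R)) <= l2.
  rewrite -[leRHS]lnK ?posrE// ler_expR sqr_sqrtr ?(ltW cn0)//.
  have ng : n%:R / m%:R <= (n - g)%:R :> R.
    rewrite ler_pdivrMr// -natrM ler_nat.
    have [ge|lt] := leqP (n %/ m).+1 n.
      by rewrite subKn// ltnW// ltn_ceil// ltnW.
    rewrite /g (eqP (ltnW lt : (n - (n %/ m).+1 == 0)%N)) subn0.
    by rewrite leq_pmulr// ltnW.
  have : c / n%:R / 2 * (n%:R / m%:R) <= c / n%:R / 2 * (n - g)%:R.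
    by rewrite ler_wpM2l// divr_ge0// ltW.
  have -> : c / n%:R / 2 * (n%:R / m%:R) = `|ln l2| + 1.
    by rewrite /c; field; rewrite !gt_eqF.
  have := ler_norm (- ln l2); rewrite normrN; lra.
have [N [N0 NE MN]] :=
  DI_code_of_packing _ _ _ _ _ _ _ pureW (ltW l10) (ltW delta0) el2 pM M0 gn.
apply: le_trans (DI_rate_ge _ _ _ _ _ N0 NE); rewrite lee_fin.
have L0 : 0 < log2 n%:R :> R by rewrite log2_gt0// ltr1n.
have N0' : 0 < N%:R :> R by rewrite ltr0n.
have M0' : 0 < M%:R :> R by rewrite ltr0n.
have logN : g%:R * log2 M%:R - n%:R <= log2 N%:R :> R.
  have two_n : log2 (2 ^+ n) = n%:R :> R by rewrite log2X// log2_2 mulr1.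
  rewrite lerBlDr -log2X// -two_n -log2M ?exprn_gt0//.
  by rewrite ler_log2 ?exprn_gt0// -!natrX -natrM ler_nat.
have gm : n%:R * (1 - m%:R^-1 - n%:R^-1) <= g%:R :> R.
  have : n%:R <= g%:R + (n%:R / m%:R + 1) :> R.
    apply: (@le_trans _ _ (g + (n %/ m).+1)%:R).
      by rewrite ler_nat addnC -leq_subLR.
    rewrite natrD lerD2l -natr1 lerD2r ler_pdivlMr// -natrM ler_nat.
    exact: leq_divM.
  have -> : n%:R * (1 - m%:R^-1 - n%:R^-1) = n%:R - (n%:R / m%:R + 1) :> R.
    by field; rewrite !gt_eqF.
  lra.
(* This is the lower bound on [log2 N] divided by [n * log2 n]; the last term is the loss from the
   factor [2 ^ n]. *)
apply: (@le_trans _ _ ((1 - m%:R^-1 - n%:R^-1) *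
    (a' * (2^-1 - k * (log2 n%:R)^-1)) - (log2 n%:R)^-1)).
  by apply: ltW; near: n; exact: near_rate_bound.
rewrite ler_pdivlMr ?(mulr_gt0 n0 L0)//; apply: le_trans logN.
have -> : ((1 - m%:R^-1 - n%:R^-1) * (a' * (2^-1 - k / log2 n%:R)) -
   (log2 n%:R)^-1) * (n%:R * log2 n%:R) =
   n%:R * (1 - m%:R^-1 - n%:R^-1) * (a' * - log2 delta) - n%:R.
  by rewrite ldelta; field; rewrite !gt_eqF.
rewrite lerD2r.
apply: (@le_trans _ _ (g%:R * (a' * - log2 delta))).
  by rewrite ler_wpM2r// mulr_ge0// ltW.
by rewrite ler_wpM2l.
Unshelve. all: by end_near. Qed.

Lemma liminf_DI_rate_le {R : realType} {d : nat} {X : Type} (W : X -> 'M[R[i]]_d) :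
  (forall x, pure_state (W x)) ->
  (limn_einf (fun n => DI_rate W n 4^-1 4^-1) <=
   (2%R^-1)%:E * lower_minkowski_dim (range W))%E.
Proof.
(* A small [delta] is handled through the block length [n = trunc (1 / (16 delta^2))],
   which is large and satisfies [- log2 delta <= log2 n / 2 + 3]. *)
move=> pureW; apply: lee_EFin_approx => b /EFin_lt_dense[b' bb' b'lim].
rewrite lee_pdivlMl// -EFinM.
(* The threshold on [log2 n] lets [(b' - b) * log2 n] absorb [6 * b], the cost of the additive 3 in
   [ldelta]. *)
have [n0 _ n0P] : \forall n \near \oo, [/\ (b'%:E < DI_rate W n 4^-1 4^-1)%E,
    6 * `|b| / (b' - b) <= log2 n%:R & (1 < n)%N].
  near=> n; split; near: n.
  - exact: (lt_limf_einf_near _ _ _ _ b'lim).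
  - by have /cvgryPge := @cvg_log2_natr R; apply.
  - exact: nbhs_infty_gt.
apply: limf_einf_ge_near; near=> delta.
have delta0 : 0 < delta by near: delta; exact: nbhs_right_gt.
have delta1 : delta < 1 by near: delta; exact: nbhs_right_lt.
(* Ensures [1 / (16 delta^2) >= n0.+1 ^ 2], so that the block length reaches [n0]. *)
have delta_n0 : delta < (4 * n0.+1%:R)^-1.
  by near: delta; apply: nbhs_right_lt; rewrite invr_gt0 mulr_gt0.
have ldelta0 : 0 < - log2 delta by rewrite -log2V// log2_gt0// invf_gt1.
have [ratio_fin|] := ltP (packing_ratio (range W) delta) +oo%E; last first.
  by rewrite leye_eq => /eqP ->; rewrite leey.
have [|M [pM npM]] := maximal_packing _ _ _ ratio_fin.
  by rewrite delta0 delta1.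
pose y := (16 * delta ^+ 2)^-1.
have den0 : 0 < 16 * delta ^+ 2 by rewrite mulr_gt0// exprn_gt0.
have y0 : 0 < y by rewrite invr_gt0.
pose n := Num.trunc y.
have /andP[ny yn] := truncn_itv (ltW y0); rewrite -/n in ny yn.
have n0n : (n0 <= n)%N.
  rewrite -ltnS -(ltr_nat R); apply: lt_trans yn.
  apply: (@lt_le_trans _ _ n0.+1%:R); first by rewrite ltr_nat.
  rewrite /y -[leLHS]invrK lef_pV2 ?posrE ?invr_gt0//.
  have -> : 16 * delta ^+ 2 = (4 * delta) ^+ 2 by ring.
  have d4 : 4 * delta <= n0.+1%:R^-1.
    by move: delta_n0; rewrite invfM -ltr_pdivrMl ?invr_gt0// invrK => /ltW.
  apply: (@le_trans _ _ (n0.+1%:R^-1 ^+ 2)).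
    by rewrite lerXn2r ?nnegrE// ?invr_ge0// mulr_ge0// ltW.
  by rewrite expr2 ler_piMl ?invr_ge0// invf_le1// ler1n.
have [/lt_DI_rate[N [N0 [u [E code]] b'N]] b'b n1] := n0P n n0n.
have nR0 : 0 < n%:R :> R by rewrite ltr0n ltnW.
have L0 : 0 < log2 n%:R :> R by rewrite log2_gt0// ltr1n.
have NM : (N <= M ^ n)%N.
  apply: (DI_code_size_le _ delta _ _ _ u E pureW (ltW delta0) _ pM npM code).
  by rewrite mulrAC -ler_pdivlMl// mulr1.
(* A code with [N >= 1] and [n > 0] excludes the empty packing. *)
have M0 : (0 < M)%N.
  by move: (leq_trans N0 NM); rewrite expn_gt0 => /orP[//|/eqP n_0]; rewrite n_0 in n1.
have M1 : 0 <= log2 M%:R :> R by rewrite log2_ge0// ler1n.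
have logM : b' * log2 n%:R < log2 M%:R.
  rewrite -(ltr_pM2l nR0); apply: (@lt_le_trans _ _ (log2 N%:R)).
    by move: b'N; rewrite ltr_pdivlMr ?(mulr_gt0 nR0 L0)// mulrCA.
  by rewrite -log2X ?ltr0n// -natrX ler_log2 ?ltr0n// ler_nat.
(* From [y < n + 1 <= 2 n], which gives the constant 5/2, rounded up to 3. *)
have ldelta : - log2 delta <= log2 n%:R / 2 + 3.
  have : log2 y <= log2 (2 * n%:R).
    apply: ler_log2 => //; apply: le_trans (ltW yn) _.
    by rewrite -natrM ler_nat mul2n -addnn -addn1 leq_add2l ltnW.
  rewrite log2M// log2_2 /y log2V// log2M ?exprn_gt0// log2X//.
  have -> : log2 16 = 4 :> R.
    by have -> : 16 = 2 ^+ 4 :> R by [ring]; rewrite log2X// log2_2 mulr1.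
  lra.
apply: le_trans (packing_ratio_ge _ _ _ M0 pM).
rewrite lee_fin ler_pdivlMr//.
have [b0|b0] := leP b 0.
  by apply: le_trans M1; rewrite mulr_le0_ge0 ?mulr_ge0_le0// ltW.
have : 2 * b * - log2 delta <= 2 * b * (log2 n%:R / 2 + 3).
  by rewrite ler_wpM2l// mulr_ge0// ltW.
move: b'b; rewrite gtr0_norm// ler_pdivrMr ?subr_gt0//.
set L := log2 n%:R in logM *; nra.
Unshelve. all: by end_near. Qed.

(** The lower bound holds for all positive errors and the upper bound at 1/4, so the infimum is
    attained there. *)
Lemma DI_cap_dot_pure {R : realType} {d : nat} {X : Type} (W : X -> 'M[R[i]]_d) :
  (forall x, pure_state (W x)) ->
  DI_cap_dot W = ((2%R^-1)%:E * lower_minkowski_dim (range W))%E.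
Proof.
move=> pureW; apply/eqP; rewrite eq_le; apply/andP; split.
  apply: le_trans (liminf_DI_rate_le W pureW); apply: ereal_inf_lbound.
  by exists 4^-1, 4^-1; rewrite invr_gt0.
apply: le_ereal_inf_tmp => _ [l1 [l2 [l10 [l20 ->]]]].
exact: liminf_DI_rate_ge.
Qed.

Theorem theorem5 (R : realType) (d : nat) (dX : measure_display)
    (X : measurableType dX) (W : X -> 'M[R[i]]_d)
    (HWmeas : forall i j : 'I_d,
        measurable_fun setT (fun x => complex.Re (W x i j)) /\
        measurable_fun setT (fun x => complex.Im (W x i j)))
    (HWdens : forall x, density_op (W x))
    (HWpure : forall x, pure_state (W x)) :
  DI_cap_dot W = ((2%R^-1)%:E * lower_minkowski_dim ((@msqrt R d) @` range W))%E /\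
  DI_cap_dot W = ((2%R^-1)%:E * lower_minkowski_dim (range W))%E.
Proof.
have -> : (@msqrt R d) @` range W = range W.
  rewrite image_comp; apply: eq_imagel => x _ /=; exact: msqrt_pure.
by rewrite DI_cap_dot_pure.
Qed.
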